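(* Let $n\ge 2$ and let $u=u(r)$ be a function such that $x\mapsto u(|x|)$ is smooth on $\mathbb{R}^n$ and $$u''+\frac{u'}{r}+e^{2u}\le 0\quad\text{for } r>0 .$$ Let $g=e^{2u(|\cdot|)}\delta$, where $\delta$ is the Euclidean metric in $\mathbb{R}^n$. Then $\mathrm{diam}_g(\mathbb{R}^n)\le\pi$.
   Context: Primes denote derivatives with respect to $r$. $d_g(x,y)$ is the infimum of the $g$-lengths of piecewise smooth curves from $x$ to $y$ (the length of $\gamma:[a,b]\to\mathbb{R}^n$ being $\int_a^b e^{u(|\gamma(t)|)}|\gamma'(t)|\,dt$), and $\mathrm{diam}_g(\mathbb{R}^n)=\sup_{x,y} d_g(x,y)$. *)

(* Defs.v *)
From HB Require Import structures.
From mathcomp Require Import all_boot all_order all_algebra.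
From mathcomp Require Import all_classical all_reals all_analysis.
Set Implicit Arguments.
Unset Strict Implicit.
Unset Printing Implicit Defensive.
Import Order.TTheory GRing.Theory Num.Theory.
Import numFieldNormedType.Exports.
Local Open Scope ring_scope.
Local Open Scope classical_set_scope.

(* The library norm on ['rV[R]_n] is the sup norm; it induces the usual topology,
   but lengths below are measured with the Euclidean norm. *)
Definition enorm (R : realType) (n : nat) (x : 'rV[R]_n) : R :=
  Num.sqrt (\sum_(i < n) x 0 i ^+ 2).

Definition iter_partial (R : realType) (n : nat) (s : seq 'I_n)
    (f : 'rV[R]_n -> R) : 'rV[R]_n -> R :=
  foldr (fun i (h : 'rV[R]_n -> R) => 'D_(delta_mx 0 i : 'rV[R]_n) h) f s.

(* C^infinity: the partial derivatives of all orders exist and are continuous.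
   The derivability clause is needed since ['D_v] is total. *)
Definition smooth (R : realType) (n : nat) (f : 'rV[R]_n -> R) : Prop :=
  forall s : seq 'I_n,
    continuous (iter_partial s f) /\
    forall (i : 'I_n) (x : 'rV[R]_n),
      derivable (iter_partial s f) x (delta_mx 0 i : 'rV[R]_n).

Definition smooth_curve (R : realType) (n : nat) (c : R -> 'rV[R]_n) : Prop :=
  forall (k : nat) (t : R), derivable (derive1n k c) t 1.

(* Smoothness on a closed subinterval, endpoints included, is the existence of
   a smooth extension to the line.  No regularity (c' <> 0) is required. *)
Definition piecewise_smooth (R : realType) (n : nat) (a b : R)
    (c : R -> 'rV[R]_n) : Prop :=
  {within `[a, b], continuous c} /\
  exists s : seq R, itv_partition a b s /\
    forall i : nat, (i < size s)%N ->
      exists c0 : R -> 'rV[R]_n, smooth_curve c0 /\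
        {in `[nth a (a :: s) i, nth a (a :: s) i.+1], c =1 c0}.

(* The total function [derive1 c] takes an arbitrary value at the endpoints and
   at the break points of a piecewise smooth curve, a Lebesgue-null set. *)
Definition glength (R : realType) (n : nat) (u : R -> R) (a b : R)
    (c : R -> 'rV[R]_n) : \bar R :=
  (\int[lebesgue_measure]_(t in `[a, b])
     (expR (u (enorm (c t))) * enorm (derive1 c t))%:E)%E.

Definition gdist (R : realType) (n : nat) (u : R -> R) (x y : 'rV[R]_n) : \bar R :=
  ereal_inf [set l | exists (a b : R) (c : R -> 'rV[R]_n),
    [/\ a < b, piecewise_smooth a b c, c a = x, c b = y
      & l = glength u a b c]].

Definition gdiam (R : realType) (n : nat) (u : R -> R) : \bar R :=
  ereal_sup [set gdist u x y | x in [set: 'rV[R]_n] & y in [set: 'rV[R]_n]].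

(* Main.v *)
Require Import Defs.
From HB Require Import structures.
From mathcomp Require Import all_boot all_order all_algebra.
From mathcomp Require Import all_classical all_reals all_analysis.
From mathcomp Require Import measurable_realfun ring lra.
Set Implicit Arguments.
Unset Strict Implicit.
Unset Printing Implicit Defensive.
Import Order.TTheory GRing.Theory Num.Theory.
Import numFieldNormedType.Exports.
Local Open Scope ring_scope.
Local Open Scope classical_set_scope.

(** The radial function [u] is replaced by its even extension [phi], that is
    [u] read along a coordinate axis, which is twice differentiable on the whole
    line.  Let [s] be the primitive of [expR \o phi] with [s 0 = 0]: [s r] is
    the length of the radial segment from the origin to the sphere of radius
    [r].  Two facts on [s] bound the diameter.

    First, [s < pi] (lemma [radius_lt_pi]).  With respect to arc length, the
    hypothesis says that [f = r * expR (phi r)], the radius seen by circles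
    around the origin, satisfies [f'' + f <= 0] with [f = 0] and [f' = 1] at the
    origin: the planes through the origin have curvature at least 1.  Sturm's
    comparison with the sine makes [f' * sin s - f * cos s] nonincreasing as
    long as [s <= pi].  It vanishes at the origin, but would equal [f > 0]
    where [s = pi].

    Second, [f] takes arbitrarily small values far from the origin (lemma
    [small_circle]): if [f] were bounded below by [e > 0], then [s], whose
    derivative is [f / r], would grow at least like [e * ln r].

    Two points at distances [a] and [b] from the origin are joined by a curve
    through the origin, of length [s a + s b], and by a curve that goes
    radially out to the sphere of radius [r], along an arc of a great circle of
    that sphere, and radially in, of length at most
    [2 * s r - s a - s b + pi * f r].  If [s a + s b <= pi] the first one will
    do; otherwise the second one is shorter than [pi + pi * f r], and [r] can
    be chosen with [f r] as small as desired.  Since [n >= 2], the unit sphere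
    is connected by such arcs (lemma [unit_rotation]). *)

(** * Comparison with the round sphere *)

Lemma primitive_expR_homo (R : realType) (phi s : R -> R) :
  (forall r : R, 0 <= r -> is_derive r 1 s (expR (phi r))) ->
  forall r1 r2 : R, 0 <= r1 -> r1 <= r2 -> s r1 <= s r2.
Proof.
move=> ds r1 r2 r10 r12.
have [t|t|t _] := @MVT_segment R s (fun r => expR (phi r)) r1 r2 r12.
- rewrite in_itv/= => /andP[r1t _]; apply: ds; exact: (le_trans r10 (ltW r1t)).
- apply: derivable_within_continuous => x; rewrite in_itv/= => /andP[r1x _].
  by have [] := ds _ (le_trans r10 r1x).
- by move/eqP; rewrite subr_eq => /eqP ->; rewrite lerDr mulr_ge0 ?expR_ge0 ?subr_ge0.
Qed.

(** Sturm comparison.  The derivative [dW] of the Wronskian [W] of the sine and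
    of [f = r * expR (phi r)], taken in the arc length parameter [s], is
    [sin s * r] times the left-hand side of the curvature inequality. *)
Lemma radius_lt_pi (R : realType) (phi dphi ddphi s : R -> R) :
  (forall r : R, is_derive r 1 phi (dphi r)) ->
  (forall r : R, is_derive r 1 dphi (ddphi r)) ->
  (forall r : R, 0 < r -> ddphi r + dphi r / r + expR (2 * phi r) <= 0) ->
  (forall r : R, 0 <= r -> is_derive r 1 s (expR (phi r))) -> s 0 = 0 ->
  forall r : R, 0 <= r -> s r < pi.
Proof.
move=> d1 d2 K ds s0 r r0; rewrite ltNge; apply/negP => pis.
have homo_s := primitive_expR_homo ds.
(* If [s] is not below [pi], it takes the value [pi] at some [q]. *)
have [q q_itv sq] : exists2 q, q \in `[0, r]%R & s q = pi.
  apply: (@IVT R s 0 r pi r0).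
    apply: derivable_within_continuous => x; rewrite in_itv/= => /andP[x0 _].
    by have [] := ds _ x0.
  have spos := homo_s _ _ (lexx 0) r0; move: spos; rewrite s0 => spos.
  by rewrite min_l// max_r// pi_ge0.
move: q_itv; rewrite in_itv/= => /andP[q0 qr].
have {}q0 : 0 < q.
  rewrite lt_neqAle q0 andbT; apply/eqP => q0'.
  by move: sq; rewrite -q0' s0 => /eqP; rewrite lt_eqF// pi_gt0.
pose W t := (1 + t * dphi t) * sin (s t) - t * expR (phi t) * cos (s t).
pose dW t := t * sin (s t) * (ddphi t + dphi t / t + expR (2 * phi t)).
have dWE (t : R) : 0 <= t -> is_derive t 1 W
   ((dphi t + t * ddphi t) * sin (s t) + t * sin (s t) * expR (2 * phi t)).
  move=> t0; have ? := ds t t0.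
  apply: is_derive_eq; rewrite /GRing.scale /= mulr_natl mulr2n expRD; ring.
have [c||] := @MVT_segment R W dW 0 q (ltW q0).
- rewrite in_itv/= => /andP[c0 _]; apply: is_derive_eq (dWE c (ltW c0)) _.
  by rewrite /dW; field; rewrite gt_eqF.
- apply: derivable_within_continuous => x; rewrite in_itv/= => /andP[x0 _].
  by have [] := dWE _ x0.
move=> c; rewrite in_itv/= => /andP[c0 cq].
have -> : W 0 = 0 by rewrite /W s0 sin0; ring.
have -> : W q = q * expR (phi q) by rewrite /W sq sinpi cospi; ring.
move=> E.
(* [W 0 = 0], so the mean value theorem gives [W q <= 0] at [s q = pi]. *)
have : 0 < q * expR (phi q) by rewrite mulr_gt0// expR_gt0.
rewrite -[X in 0 < X]subr0 E subr0 ltNge => /negP; apply.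
rewrite mulr_le0_ge0 ?(ltW q0)//.
have [->|cn0] := eqVneq c 0; first by rewrite /dW !mul0r.
have {cn0}c0' : 0 < c by rewrite lt_neqAle eq_sym cn0.
rewrite /dW mulr_ge0_le0//; last exact: K.
rewrite mulr_ge0// sin_ge0_pi// -{1}s0 -sq; apply/andP; split; exact: homo_s.
Qed.

(** A lower bound [e] on [r * expR (phi r)] for [r >= M] would make
    [s r - e * ln r] nondecreasing there, so that [s] would exceed [pi]. *)
Lemma small_circle (R : realType) (phi s : R -> R) :
  (forall r : R, 0 <= r -> is_derive r 1 s (expR (phi r))) -> s 0 = 0 ->
  (forall r : R, 0 <= r -> s r < pi) ->
  forall M e : R, 0 < e -> exists2 r, M <= r & 0 < r /\ r * expR (phi r) <= e.
Proof.
move=> ds s0 spi M e e0; apply: contrapT => large.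
pose M' := Num.max M 1.
have M'0 : 0 < M' by rewrite lt_max ltr01 orbT.
have {}large (r : R) : M' <= r -> e < r * expR (phi r).
  move=> M'r; rewrite ltNge; apply/negP => small; apply: large.
  exists r; first by apply: le_trans M'r; rewrite le_max lexx.
  by split => //; exact: lt_le_trans M'0 M'r.
(* Between [M'] and [N] the function [e * ln] increases by exactly [pi]. *)
pose N := M' * expR (pi / e).
have M'N : M' <= N by rewrite ler_peMr ?ltW// -expR0 ltr_expR divr_gt0// pi_gt0.
have N0 : 0 < N by exact: lt_le_trans M'0 M'N.
have dG (t : R) : 0 < t -> is_derive t 1 (fun r => s r - e * ln r) (expR (phi t) - e * t^-1).
  move=> t0; have ? := ds t (ltW t0); have ? := is_derive1_ln t0.
  by apply: is_derive_eq; rewrite /GRing.scale/=; ring.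
have [t|t|t] := @MVT_segment R (fun r => s r - e * ln r) (fun t => expR (phi t) - e * t^-1) M' N M'N.
- by rewrite in_itv/= => /andP[M't _]; apply: dG; exact: lt_trans M'0 M't.
- apply: derivable_within_continuous => x; rewrite in_itv/= => /andP[M'x _].
  by have [] := dG _ (lt_le_trans M'0 M'x).
rewrite in_itv/= => /andP[M't _] E.
have t0 : 0 < t by exact: lt_le_trans M'0 M't.
have : 0 <= s N - e * ln N - (s M' - e * ln M').
  rewrite E mulr_ge0 ?subr_ge0// ler_pdivrMr// mulrC.
  exact/ltW/large.
rewrite /N lnM ?posrE ?expR_gt0// expRK -/N mulrDr.
rewrite mulrCA divff ?gt_eqF// mulr1.
have := spi _ (ltW N0).
have := primitive_expR_homo ds (lexx 0) (ltW M'0); rewrite s0.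
lra.
Qed.

(** * Euclidean geometry of row vectors *)

Section euclidean.
Context {R : realType} {n : nat}.
Implicit Types x y : 'rV[R]_n.

Definition dot x y : R := \sum_(i < n) x 0 i * y 0 i.

Lemma enormE x : enorm x = Num.sqrt (dot x x).
Proof. by []. Qed.

Lemma dotC x y : dot x y = dot y x.
Proof. by apply: eq_bigr => i _; rewrite mulrC. Qed.

Lemma dotDl x y z : dot (x + y) z = dot x z + dot y z.
Proof. by rewrite -big_split; apply: eq_bigr => i _; rewrite mxE mulrDl. Qed.

Lemma dotZl (a : R) x z : dot (a *: x) z = a * dot x z.
Proof. by rewrite mulr_sumr; apply: eq_bigr => i _; rewrite mxE mulrA. Qed.

Lemma dotDr x y z : dot z (x + y) = dot z x + dot z y.
Proof. by rewrite dotC dotDl !(dotC z). Qed.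

Lemma dotZr (a : R) x z : dot z (a *: x) = a * dot z x.
Proof. by rewrite dotC dotZl dotC. Qed.

Lemma dot_ge0 x : 0 <= dot x x.
Proof. by apply: sumr_ge0 => i _; rewrite -expr2 sqr_ge0. Qed.

Lemma dot_eq0 x : dot x x = 0 -> x = 0.
Proof.
move=> /eqP; rewrite psumr_eq0; last by move=> i _; rewrite -expr2 sqr_ge0.
move=> /allP z; apply/rowP => i; rewrite mxE.
by have := z i (mem_index_enum _); rewrite /= mulf_eq0 orbb => /eqP.
Qed.

Lemma enormZ (a : R) x : enorm (a *: x) = `|a| * enorm x.
Proof. by rewrite !enormE dotZl dotZr mulrA -expr2 sqrtrM ?sqr_ge0// sqrtr_sqr. Qed.

Lemma enorm_ge0 x : 0 <= enorm x.
Proof. exact: sqrtr_ge0. Qed.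

Lemma enorm0 : enorm (0 : 'rV[R]_n) = 0.
Proof. by rewrite -(scale0r 0) enormZ normr0 mul0r. Qed.

Lemma enorm_unit x : enorm x = 1 -> dot x x = 1.
Proof. by move=> x1; rewrite -(sqr_sqrtr (dot_ge0 x)) -enormE x1 expr1n. Qed.

(** The unit vector [v] serves as the direction of the zero vector. *)
Lemma polar_decomposition (v : 'rV[R]_n) x : enorm v = 1 ->
  exists2 w, enorm w = 1 & x = enorm x *: w.
Proof.
move=> v1; have [x0|xn0] := eqVneq (enorm x) 0.
  exists v => //; rewrite x0 scale0r; apply: dot_eq0.
  by rewrite -(sqr_sqrtr (dot_ge0 x)) -enormE x0 expr0n.
exists ((enorm x)^-1 *: x); last by rewrite scalerA divff// scale1r.
by rewrite enormZ ger0_norm ?invr_ge0 ?enorm_ge0// mulVf.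
Qed.

Lemma enorm_delta (i : 'I_n) : enorm (delta_mx 0 i : 'rV[R]_n) = 1.
Proof.
rewrite enormE /dot (bigD1 i)//= big1 => [|j ji].
  by rewrite !mxE !eqxx mulr1 addr0 sqrtr1.
by rewrite !mxE (negbTE ji) andbF mul0r.
Qed.

Lemma exists_orthogonal_unit x : (2 <= n)%N ->
  exists2 w, enorm w = 1 & dot x w = 0.
Proof.
move=> n2.
have [w wn0 xw] : exists2 w, w != 0 & dot x w = 0.
  pose i0 : 'I_n := Ordinal (ltnW n2); pose i1 : 'I_n := Ordinal n2.
  have i01 : i0 != i1 by [].
  have dotd i : dot x (delta_mx 0 i) = x 0 i.
    rewrite /dot (bigD1 i)//= big1 => [|j ji].
      by rewrite !mxE !eqxx mulr1 addr0.
    by rewrite !mxE (negbTE ji) andbF mulr0.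
  have [x0|x0] := eqVneq (x 0 i0) 0.
    exists (delta_mx 0 i0); last by rewrite dotd.
    apply/eqP => /(congr1 (@enorm R n)); rewrite enorm_delta enorm0.
    by move/eqP; rewrite oner_eq0.
  exists (x 0 i1 *: delta_mx 0 i0 - x 0 i0 *: delta_mx 0 i1).
    apply/eqP => /rowP/(_ i1); rewrite !mxE eqxx eq_sym (negbTE i01) andbF /=.
    by rewrite mulr0 mulr1 sub0r => /eqP; rewrite oppr_eq0 (negbTE x0).
  by rewrite -scaleNr dotDr !dotZr !dotd mulNr mulrC subrr.
have [v v1 wE] := polar_decomposition w (enorm_delta (Ordinal n2)).
exists v => //.
have : enorm w != 0 by apply: contra_neq wn0 => w0; rewrite wE w0 scale0r.
by move: xw; rewrite wE dotZr => /eqP; rewrite mulf_eq0 => /orP[/eqP->|/eqP//]; rewrite ?scale0r ?enorm0 ?eqxx.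
Qed.

(** Gram-Schmidt: [w] is the normalised component of [y] orthogonal to [x], or
    any unit vector orthogonal to [x] when [y] is [x] or [- x]; the latter
    exists because the dimension is at least 2. *)
Lemma unit_rotation x y : (2 <= n)%N -> enorm x = 1 -> enorm y = 1 ->
  exists (theta : R) w, [/\ 0 <= theta <= pi, enorm w = 1, dot x w = 0
    & y = cos theta *: x + sin theta *: w].
Proof.
move=> n2 x1 y1.
have [v v1 xv] := exists_orthogonal_unit x n2.
pose c := dot x y; pose z := y - c *: x.
have xz : dot x z = 0.
  by rewrite /z -scaleNr dotDr dotZr (enorm_unit x1) mulr1 subrr.
have [w [w1 xw zE]] : exists w, [/\ enorm w = 1, dot x w = 0 & z = enorm z *: w].
  have [w w1 zE] := polar_decomposition z v1.
  have [z0|zn0] := eqVneq (enorm z) 0.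
    by exists v; split => //; rewrite z0 scale0r {1}zE z0 scale0r.
  exists w; split => //; move: xz; rewrite zE dotZr => /eqP.
  by rewrite mulf_eq0 (negbTE zn0) => /eqP.
have yE : y = c *: x + enorm z *: w by rewrite -zE addrC subrK.
have cz : c ^+ 2 + enorm z ^+ 2 = 1.
  rewrite -(enorm_unit y1) {1}yE [in RHS]yE !(dotDl, dotDr, dotZl, dotZr).
  rewrite (dotC w x) xw (enorm_unit x1) (enorm_unit w1); ring.
have c11 : -1 <= c <= 1.
  by rewrite -ler_norml -(@expr_le1 _ 2)// real_normK ?num_real// -cz lerDl sqr_ge0.
exists (acos c), w; split => //; first by rewrite acos_ge0// acos_lepi.
have s2 : 1 - c ^+ 2 = enorm z ^+ 2 by rewrite -cz; ring.
by rewrite acosK// sin_acos// s2 sqrtr_sqr ger0_norm ?enorm_ge0.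
Qed.

Lemma enorm_rotation x w (r a b : R) : 0 <= r -> enorm x = 1 -> enorm w = 1 -> dot x w = 0 ->
  a ^+ 2 + b ^+ 2 = 1 ->
  enorm ((r * a) *: x + (r * b) *: w) = r.
Proof.
move=> r0 x1 w1 xw ab; rewrite enormE !(dotDl, dotDr, dotZl, dotZr).
rewrite (dotC w x) xw (enorm_unit x1) (enorm_unit w1).
rewrite -[RHS](ger0_norm r0) -sqrtr_sqr; congr Num.sqrt.
by rewrite -[RHS]mulr1 -[X in _ = _ * X]ab; ring.
Qed.

End euclidean.

(** * The radial profile *)

Lemma is_derive_along_line (R : realType) (V W : normedModType R) (f : V -> W) (v : V) (r : R) :
  derivable f (r *: v) v ->
  is_derive r 1 (fun t : R => f (t *: v)) ('D_v f (r *: v)).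
Proof.
have E : (fun h : R => h^-1 *: (f (h *: v + r *: v) - f (r *: v))) =
         (fun h : R => h^-1 *: (f ((h *: 1 + r) *: v) - f (r *: v))).
  by apply/funext => h; rewrite [h *: 1]mulr1 scalerDl.
by move=> df; split; rewrite /derivable /derive/= -E.
Qed.

(** Integrating from -1 rather than from 0 makes the integral differentiable
    at 0 too, where one-sided derivatives would be awkward. *)
Lemma exists_primitive (R : realType) (f : R -> R) : continuous f ->
  exists2 F : R -> R, F 0 = 0 & forall r : R, 0 <= r -> is_derive r 1 F (f r).
Proof.
move=> cf; pose F (x : R) := (\int[lebesgue_measure]_(t in `[(-1 : R), x]) f t)%R.
exists (fun x => F x - F 0); first by rewrite subrr.
move=> r r0.
have ltr : r < r + 1 by rewrite ltrDl.
have lt1r : (-1 : R) < r by rewrite (lt_le_trans _ r0)// ltrN10.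
have [|dF FE] := continuous_FTC1_closed ltr _ lt1r (cf r).
  apply: continuous_compact_integrable; first exact: segment_compact.
  exact: continuous_subspaceT.
rewrite -/F in dF FE; have : is_derive r (1 : R) F (f r).
  by rewrite -FE derive1E; exact: derivableP.
by move=> ?; apply: is_derive_eq; rewrite subr0.
Qed.

(** The profile is [u] along a coordinate axis, [r |-> u `|r|].  Its
    derivatives are the partial derivatives of [u \o enorm] along that axis, so
    it is differentiable at 0 as well, whatever [u] does on negative reals. *)
Lemma radial_profile (R : realType) (n : nat) (u : R -> R) : (0 < n)%N ->
  smooth (fun x : 'rV[R]_n => u (enorm x)) ->
  exists phi dphi ddphi : R -> R,
  [/\ forall r : R, 0 <= r -> phi r = u r,
    forall r : R, is_derive r 1 phi (dphi r),
    forall r : R, is_derive r 1 dphi (ddphi r) &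
    forall r : R, 0 < r -> dphi r = derive1 u r /\ ddphi r = derive1n 2 u r].
Proof.
move=> n0 hu; pose i : 'I_n := Ordinal n0; pose e : 'rV[R]_n := delta_mx 0 i.
pose h := iter_partial [::] (fun x : 'rV[R]_n => u (enorm x)).
pose dh := iter_partial [:: i] (fun x : 'rV[R]_n => u (enorm x)).
have d1 (r : R) : is_derive r 1 (fun t => h (t *: e)) (dh (r *: e)).
  by apply: is_derive_along_line; have [_] := hu [::]; exact.
have d2 (r : R) : is_derive r 1 (fun t => dh (t *: e)) ('D_e dh (r *: e)).
  by apply: is_derive_along_line; have [_] := hu [:: i]; exact.
have hE (r : R) : 0 <= r -> h (r *: e) = u r.
  by move=> r0; rewrite /h/= enormZ enorm_delta mulr1 ger0_norm.
have dhE (r : R) : 0 < r -> dh (r *: e) = derive1 u r.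
  move=> r0; rewrite -(@derive_val _ _ _ _ _ _ _ (d1 r)) derive1E.
  apply: near_eq_derive; near=> t; apply: hE; apply: ltW.
  by near: t; exact: lt_nbhsr.
exists (fun t => h (t *: e)), (fun t => dh (t *: e)), (fun t => 'D_e dh (t *: e)).
split; [exact: hE|exact: d1|exact: d2|move=> r r0; split; first exact: dhE].
rewrite -(@derive_val _ _ _ _ _ _ _ (d2 r)) derive1nS derive1n1 derive1E.
apply: near_eq_derive; near=> t; apply: dhE.
by near: t; exact: lt_nbhsr.
Unshelve. all: by end_near. Qed.

(** * Curves of prescribed length *)

Section curves.
Context {R : realType} {n : nat} (u : R -> R).
Implicit Types (x y : 'rV[R]_n) (c : R -> 'rV[R]_n).

Definition speed c (t : R) : R := expR (u (enorm (c t))) * enorm (derive1 c t).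

(** The degenerate case [a = b] is included because [gdist] ranges over curves on
    intervals of positive length, whereas the radial segments and arcs used
    below may reduce to a point.  Measurability of the speed is
    what makes lengths additive under concatenation. *)
Definition path_of_length (a b : R) x y (l : R) :=
  [/\ a = b, x = y & l = 0] \/
  exists c, [/\ a < b, piecewise_smooth a b c, c a = x, c b = y
    & measurable_fun `[a, b] (speed c) /\ glength u a b c = l%:E].

Lemma speed_ge0 c t : 0 <= speed c t.
Proof. by rewrite mulr_ge0 ?expR_ge0 ?enorm_ge0. Qed.

(** Speed is a local notion; hence a glued curve has the speed of its pieces
    except at the point where they meet. *)
Lemma speed_near c1 c2 (t : R) : (\near t, c1 t = c2 t) -> speed c1 t = speed c2 t.
Proof.
by move=> c12; rewrite /speed !derive1E (nbhs_singleton c12) (near_eq_derive _ c12).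
Qed.

Definition glue (b : R) c1 c2 (t : R) := if t <= b then c1 t else c2 t.

Lemma speed_glue_lt b c1 c2 (t : R) : t < b -> speed (glue b c1 c2) t = speed c1 t.
Proof.
move=> tb; apply: speed_near; near=> z; rewrite /glue ifT//; apply: ltW.
by near: z; exact: lt_nbhsl.
Unshelve. all: by end_near. Qed.

Lemma speed_glue_gt b c1 c2 (t : R) : b < t -> speed (glue b c1 c2) t = speed c2 t.
Proof.
move=> bt; apply: speed_near; near=> z; rewrite /glue ifF//; apply: lt_geF.
by near: z; exact: lt_nbhsr.
Unshelve. all: by end_near. Qed.

Lemma piecewise_smooth_glue (a b d : R) c1 c2 : c1 b = c2 b ->
  piecewise_smooth a b c1 -> piecewise_smooth b d c2 ->
  piecewise_smooth a d (glue b c1 c2).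
Proof.
move=> c12 [cc1 [s1 [ps1 sm1]]] [cc2 [s2 [ps2 sm2]]].
have ab := itv_partition_le ps1; have bd := itv_partition_le ps2.
have glue1 t : t <= b -> c1 t = glue b c1 c2 t by move=> tb; rewrite /glue ifT.
have glue2 t : b <= t -> c2 t = glue b c1 c2 t.
  by rewrite /glue le_eqVlt => /predU1P[<-|bt]; [rewrite lexx|rewrite lt_geF].
split.
  have -> : `[a, d]%classic = `[a, b] `|` `[b, d].
    apply/seteqP; split => t /=; rewrite !in_itv/=.
      by case/andP => at_ td; case: (leP t b) => tb; [left|right]; rewrite ?at_ ?td ?(ltW tb).
    case=> /andP[h1 h2]; rewrite ?h1 ?h2 ?andbT/=; first exact: le_trans h2 bd.
    exact: le_trans ab h1.
  apply: withinU_continuous.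
  - exact: itv_closed.
  - exact: itv_closed.
  - apply: subspace_eq_continuous cc1 => t; rewrite inE/= in_itv/= => /andP[_ tb].
    exact: glue1.
  - apply: subspace_eq_continuous cc2 => t; rewrite inE/= in_itv/= => /andP[bt _].
    exact: glue2.
exists (s1 ++ s2); split; first exact: itv_partition_cat ps1 ps2.
move=> i; rewrite size_cat => isz.
(* The first [size s1] pieces are those of [c1], the others those of [c2]. *)
have [i1|i1] := ltnP i (size s1).
  have [c0 [sc0 c10]] := sm1 i i1.
  exists c0; split=> // t.
  rewrite -cat_cons !nth_cat /= ltnS (ltnW i1) ltnS i1 => tI.
  rewrite -(c10 _ tI) -glue1//.
  move: tI; rewrite inE/= in_itv/= => /andP[_ /le_trans]; apply.
  have := @itv_partition_nth_le _ _ a b s1 i.+1 _ ps1.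
  by rewrite /= ltnS => /(_ i1); rewrite (set_nth_default a).
have i2 : (i - size s1 < size s2)%N by rewrite ltn_subLR.
(* The nodes from [size s1] on are those of [s2], starting with [b] itself,
   which is both the last node of [s1] and the origin of [s2]. *)
have nthE j : (size s1 <= j)%N -> (j - size s1 < (size s2).+1)%N ->
    nth a (a :: s1 ++ s2) j = nth b (b :: s2) (j - size s1).
  move=> s1j js2; rewrite -cat_cons nth_cat /= ltnS.
  have [js1|js1] := leqP j (size s1).
    have -> : j = size s1 by apply/eqP; rewrite eqn_leq js1.
    by rewrite subnn/= (itv_partition_nth_size _ ps1).
  rewrite subnS -[in RHS](prednK (_ : 0 < j - size s1)%N) ?subn_gt0//=.
  apply: set_nth_default; rewrite -ltnS prednK// subn_gt0//.
rewrite nthE//; last by rewrite ltnW.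
rewrite nthE; [|exact: leqW|by rewrite subSn].
rewrite subSn//.
have [c0 [sc0 c20]] := sm2 _ i2.
exists c0; split=> // t tI; rewrite -(c20 _ tI) -glue2//.
move: tI; rewrite inE/= in_itv/= => /andP[+ _]; apply: le_trans.
have := @itv_partition_nth_ge _ _ b d s2 (i - size s1) _ ps2.
rewrite (set_nth_default b); last by rewrite /= ltnW.
by apply; exact: ltnW.
Qed.

(** The two integrals overlap at [b] only, where the speed of the glued curve is
    arbitrary; removing [b] from both intervals changes neither integral. *)
Lemma path_of_length_cat (a b d : R) x y z (l m : R) :
  path_of_length a b x y l -> path_of_length b d y z m ->
  path_of_length a d x z (l + m).
Proof.
case=> [[-> -> ->]|[c1 [ab pc1 c1a c1b [mc1 lc1]]]]; first by rewrite add0r.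
case=> [[<- <- ->]|[c2 [bd pc2 c2b c2d [mc2 lc2]]]].
  by rewrite addr0; right; exists c1.
right; exists (glue b c1 c2).
have adE : `[a, d]%classic = `[a, b[ `|` `[b, d].
  by apply: itv_bndbnd_setU; rewrite bnd_simp ltW.
have bdE : `[b, d]%classic = [set b] `|` `]b, d].
  by rewrite setU1itv// bnd_simp ltW.
have e1 : {in `[a, b[%classic, speed c1 =1 speed (glue b c1 c2)}.
  by move=> t; rewrite inE/= in_itv/= => /andP[_ tb]; rewrite speed_glue_lt.
have e2 : {in `]b, d]%classic, speed c2 =1 speed (glue b c1 c2)}.
  by move=> t; rewrite inE/= in_itv/= => /andP[bt _]; rewrite speed_glue_gt.
have m1 : measurable_fun `[a, b[ (speed (glue b c1 c2)).
  apply: eq_measurable_fun e1 _; apply: measurable_funS mc1; first exact: measurable_itv.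
  exact: subset_itv_co_cc.
have m2 : measurable_fun `]b, d] (speed (glue b c1 c2)).
  apply: eq_measurable_fun e2 _; apply: measurable_funS mc2; first exact: measurable_itv.
  exact: subset_itv_oc_cc.
have m2' : measurable_fun `[b, d] (speed (glue b c1 c2)).
  rewrite bdE; apply/(measurable_funU _ (measurable_set1 b) (measurable_itv _)).
  by split; [exact: measurable_fun_set1|exact: m2].
have m12 : measurable_fun `[a, d] (speed (glue b c1 c2)).
  rewrite adE; apply/(measurable_funU _ (measurable_itv _) (measurable_itv _)).
  by split; [exact: m1|exact: m2'].
split; first exact: lt_trans bd.
- by apply: piecewise_smooth_glue => //; rewrite c1b c2b.
- by rewrite /glue ltW.
- by rewrite /glue lt_geF.
split; first exact: m12.
have lE : glength u a d (glue b c1 c2) =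
    (\int[lebesgue_measure]_(t in `[a, b[) (speed (glue b c1 c2) t)%:E +
     \int[lebesgue_measure]_(t in `]b, d]) (speed (glue b c1 c2) t)%:E)%E.
  have -> := @integral_itv_obnd_cbnd R b (BRight d) (EFin \o speed (glue b c1 c2)).
    rewrite /glength adE; apply: ge0_integral_setU.
    - exact: measurable_itv.
    - exact: measurable_itv.
    - by rewrite -adE; apply/measurable_EFinP; exact: m12.
    - by move=> t _; rewrite lee_fin; exact: speed_ge0.
    - apply/disj_setPS => t [/=]; rewrite !in_itv/= => /andP[_ tb] /andP[bt _].
      by move: tb; rewrite ltNge bt.
  by apply/measurable_EFinP; exact: m2.
have i1 : (\int[lebesgue_measure]_(t in `[a, b[) (speed (glue b c1 c2) t)%:E = l%:E)%E.
  rewrite -[RHS]lc1.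
  transitivity (\int[lebesgue_measure]_(t in `[a, b[) (speed c1 t)%:E)%E.
    by apply: eq_integral => t tab; rewrite (e1 t tab).
  apply: integral_itv_bndo_bndc; apply/measurable_EFinP; apply: measurable_funS mc1; first exact: measurable_itv.
  exact: subset_itv_co_cc.
have i2 : (\int[lebesgue_measure]_(t in `]b, d]) (speed (glue b c1 c2) t)%:E = m%:E)%E.
  rewrite -[RHS]lc2.
  transitivity (\int[lebesgue_measure]_(t in `]b, d]) (speed c2 t)%:E)%E.
    by apply: eq_integral => t tbd; rewrite (e2 t tbd).
  apply: integral_itv_obnd_cbnd; apply/measurable_EFinP; apply: measurable_funS mc2; first exact: measurable_itv.
  exact: subset_itv_oc_cc.
by rewrite [LHS]lE i1 i2.
Qed.

End curves.

(** * Radial segments and circular arcs *)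

Section smooth_pieces.
Context {R : realType} {n : nat}.
Implicit Types (v w : 'rV[R]_n) (c : R -> 'rV[R]_n).

Lemma is_derive_scalel (V : normedModType R) (f : R -> R) (df t : R) (v : V) :
  is_derive t 1 f df -> is_derive t 1 (fun t => f t *: v) (df *: v).
Proof.
move=> [fd <-].
have E : (fun h : R => h^-1 *: (f (h *: 1 + t) *: v - f t *: v)) =
         (fun h : R => (h^-1 *: (f (h *: 1 + t) - f t)) *: v).
  by apply/funext => h; rewrite -scalerBl scalerA.
have lim_v : (fun h : R => h^-1 *: (f (h *: 1 + t) *: v - f t *: v)) @ 0^' -->
    'D_1 f t *: v.
  by rewrite E; apply: cvgZr_tmp; exact: fd.
split; first by apply/cvg_ex; exists ('D_1 f t *: v).
exact: cvg_lim lim_v.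
Qed.

(** All derivatives exist as soon as the curve belongs to a class of derivable
    curves that is closed under derivation; lines (with constants) and circles
    form such classes. *)
Lemma smooth_curve_coind (P : (R -> 'rV[R]_n) -> Prop) :
  (forall c, P c -> (forall t : R, derivable c t 1) /\ P (derive1 c)) ->
  forall c, P c -> smooth_curve c.
Proof.
move=> stable c Pc k.
suff Pk : P (derive1n k c) by have [] := stable _ Pk.
by elim: k => [//|k IHk]; rewrite derive1nS; have [] := stable _ IHk.
Qed.

(** Only lines through the origin are needed: [k] is the signed distance to the
    origin at time 0, and the sign of [e] tells outward from inward motion. *)
Definition line (k e : R) w (t : R) := (k + e * t) *: w.

Lemma is_derive_line (k e : R) w (t : R) : is_derive t 1 (line k e w) (e *: w).
Proof.
apply: is_derive_scalel; apply: is_derive_eq; rewrite /GRing.scale/=; ring.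
Qed.

Lemma smooth_line (k e : R) w : smooth_curve (line k e w).
Proof.
apply: (@smooth_curve_coind (fun c => exists k e, c = line k e w)); last by exists k, e.
move=> _ [k' [e' ->]]; split.
  by move=> t; have [] := is_derive_line k' e' w t.
exists e', 0; apply/funext => t.
have dl := is_derive_line k' e' w t.
by rewrite derive1E derive_val /line mul0r addr0.
Qed.

(** A unit speed circle when [v] and [w] are orthonormal. *)
Definition circle v w (t : R) := cos t *: v + sin t *: w.

Lemma is_derive_circle v w (t : R) : is_derive t 1 (circle v w) (circle w (- v) t).
Proof.
have d1 := is_derive_scalel v (is_derive_cos t).
have d2 := is_derive_scalel w (is_derive_sin t).
apply: is_derive_eq; by rewrite /circle addrC scalerN scaleNr.
Qed.

Lemma smooth_circle v w : smooth_curve (circle v w).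
Proof.
apply: (@smooth_curve_coind (fun c => exists v w, c = circle v w)); last by exists v, w.
move=> _ [v' [w' ->]]; split.
  by move=> t; have [] := is_derive_circle v' w' t.
exists w', (- v'); apply/funext => t.
have dl := is_derive_circle v' w' t.
by rewrite derive1E derive_val.
Qed.

Context (u : R -> R).

(** The length is computed by the fundamental theorem of calculus from any
    primitive [G] of a continuous expression [f] of the speed. *)
Lemma smooth_path_of_length c (f G : R -> R) (a b l : R) v w :
  a <= b -> smooth_curve c -> c a = v -> c b = w -> G b - G a = l ->
  (forall t : R, a <= t <= b -> speed u c t = f t) ->
  (forall t : R, a <= t <= b -> is_derive t 1 G (f t)) ->
  {within `[a, b], continuous f} ->
  path_of_length u a b v w l.
Proof.
rewrite le_eqVlt => /predU1P[<-|ab] sc <- <- <- spf dG cf.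
  by left; split => //; rewrite subrr.
right; exists c.
have spE : {in `[a, b]%classic, f =1 speed u c}.
  by move=> t; rewrite inE/= in_itv/= => tab; rewrite spf.
have cc (t : R) : {for t, continuous c}.
  by apply/differentiable_continuous/derivable1_diffP; exact: (sc 0).
have cG (t : R) : a <= t <= b -> {for t, continuous G}.
  move=> tab; apply/differentiable_continuous/derivable1_diffP.
  by have [] := dG t tab.
split => //.
- split; first by apply: continuous_subspaceT => t; exact: cc.
  exists [:: b]; split; first exact: itv_partition1.
  by case=> // _; exists c; split.
split.
  apply: eq_measurable_fun spE _.
  apply: subspace_continuous_measurable_fun => //; exact: measurable_itv.
transitivity (\int[lebesgue_measure]_(t in `[a, b]) (f t)%:E)%E.
  by apply: eq_integral => t tab; rewrite spE.
rewrite (@continuous_FTC2 R f G a b ab cf); first by rewrite -EFinB.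
- split.
  + move=> t; rewrite in_itv/= => /andP[at_ tb].
    by have [] := dG t; rewrite ?(ltW at_) ?(ltW tb).
  + by apply: cvg_at_right_filter; apply: cG; rewrite lexx ltW.
  + by apply: cvg_at_left_filter; apply: cG; rewrite lexx ltW.
- move=> t; rewrite in_itv/= => /andP[at_ tb].
  have d : is_derive t 1 G (f t) by apply: dG; rewrite !ltW.
  by rewrite derive1E derive_val.
Qed.

(** The degenerate path has no curve on an interval of positive length behind
    it; the constant curve on the unit interval replaces it. *)
Lemma gdist_le_path (a b : R) v w (l : R) : path_of_length u a b v w l ->
  (gdist u v w <= l%:E)%E.
Proof.
have le_real a' b' l' c : a' < b' -> piecewise_smooth a' b' c -> c a' = v ->
    c b' = w -> glength u a' b' c = l'%:E -> (gdist u v w <= l'%:E)%E.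
  by move=> *; apply: ereal_inf_lbound; exists a', b', c; split.
case=> [[_ vw ->]|[c [ab pc ca cb [_ lc]]]]; last exact: le_real lc.
have : path_of_length u 0 1 v v 0.
  apply: (@smooth_path_of_length (line 1 0 v) (cst 0) (cst 0)).
  - exact: ler01.
  - exact: smooth_line.
  - by rewrite /line mul0r addr0 scale1r.
  - by rewrite /line mul0r addr0 scale1r.
  - by rewrite subrr.
  - move=> t _; have d := is_derive_line 1 0 v t.
    by rewrite /speed derive1E derive_val scale0r enorm0 mulr0.
  - by apply: continuous_subspaceT => t; exact: cvg_cst.
case=> [[/eqP]|[c [c01 pc c0 c1 [_ lc]]]]; first by rewrite eq_sym oner_eq0.
by apply: le_real lc => //; rewrite -vw.
Qed.

(** * Two ways of joining two points *)

Context (phi s : R -> R) (phiE : forall r : R, 0 <= r -> phi r = u r).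
Context (cphi : continuous phi).
Context (ds : forall r : R, 0 <= r -> is_derive r 1 s (expR (phi r))).

Lemma speed_line (k e : R) w (t : R) : `|e| = 1 -> enorm w = 1 -> 0 <= k + e * t ->
  speed u (line k e w) t = expR (phi (k + e * t)).
Proof.
move=> e1 w1 r0; have d := is_derive_line k e w t.
rewrite /speed derive1E derive_val enormZ e1 w1 !mulr1.
by rewrite /line enormZ w1 mulr1 ger0_norm// phiE.
Qed.

Lemma continuous_expR_affine (k e : R) : continuous (fun t => expR (phi (k + e * t))).
Proof.
move=> t.
apply: (@continuous_comp _ _ _ (fun t => phi (k + e * t)) (@expR R)); last exact: continuous_expR.
apply: (@continuous_comp _ _ _ (fun t => k + e * t) phi); last exact: cphi.
by apply: cvgD; [exact: cvg_cst|apply: cvgM; [exact: cvg_cst|exact: cvg_id]].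
Qed.

(** The shift [k] lets the parameter interval be matched with the preceding or
    following piece of a concatenation. *)
Lemma path_outwards (a b k : R) w : 0 <= a -> a <= b -> enorm w = 1 ->
  path_of_length u (a - k) (b - k) (a *: w) (b *: w) (s b - s a).
Proof.
move=> a0 ab w1.
apply: (@smooth_path_of_length (line k 1 w)
  (fun t => expR (phi (k + 1 * t))) (fun t => s (k + 1 * t))).
- by rewrite lerD2r.
- exact: smooth_line.
- by rewrite /line mul1r addrC subrK.
- by rewrite /line mul1r addrC subrK.
- by rewrite !mul1r ![k + _]addrC !subrK.
- move=> t /andP[akt _]; apply: speed_line; rewrite ?normr1// mul1r.
  by apply: le_trans a0 _; rewrite -lerBlDl.
- move=> t /andP[akt _].
  have d : is_derive (k + 1 * t) 1 s (expR (phi (k + 1 * t))).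
    by apply: ds; rewrite mul1r; apply: le_trans a0 _; rewrite -lerBlDl.
  have d' : is_derive t 1 (fun t : R => k + 1 * t) 1.
    by apply: is_derive_eq; rewrite /GRing.scale/=; ring.
  by have := @is_derive1_comp _ s (fun t => k + 1 * t) _ _ _ d d'; rewrite mulr1.
- by apply: continuous_subspaceT; exact: continuous_expR_affine.
Qed.

Lemma path_inwards (a b k : R) w : 0 <= a -> a <= b -> enorm w = 1 ->
  path_of_length u (k - b) (k - a) (b *: w) (a *: w) (s b - s a).
Proof.
move=> a0 ab w1.
apply: (@smooth_path_of_length (line k (-1) w)
  (fun t => expR (phi (k + -1 * t))) (fun t => - s (k + -1 * t))).
- by rewrite lerD2l lerN2.
- exact: smooth_line.
- by rewrite /line mulN1r subKr.
- by rewrite /line mulN1r subKr.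
- by rewrite !mulN1r !subKr opprK addrC.
- move=> t /andP[_ tka]; apply: speed_line; rewrite ?normrN1// mulN1r.
  by apply: le_trans a0 _; rewrite lerBrDr -lerBrDl.
- move=> t /andP[_ tka].
  have d : is_derive (k + -1 * t) 1 s (expR (phi (k + -1 * t))).
    by apply: ds; rewrite mulN1r; apply: le_trans a0 _; rewrite lerBrDr -lerBrDl.
  have d' : is_derive t 1 (fun t : R => k + -1 * t) (-1).
    by apply: is_derive_eq; rewrite /GRing.scale/=; ring.
  have d2 := @is_derive1_comp _ s (fun t => k + -1 * t) _ _ _ d d'.
  have := is_deriveN d2; rewrite mulrN1 opprK; exact.
- by apply: continuous_subspaceT; exact: continuous_expR_affine.
Qed.

Lemma path_arc (r theta : R) v w : 0 <= r -> 0 <= theta ->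
  enorm v = 1 -> enorm w = 1 -> dot v w = 0 ->
  path_of_length u 0 theta (r *: v) (r *: (cos theta *: v + sin theta *: w))
    (theta * (r * expR (phi r))).
Proof.
move=> r0 th0 v1 w1 vw.
pose C := r * expR (phi r).
apply: (@smooth_path_of_length (circle (r *: v) (r *: w)) (cst C) (fun t => t * C)).
- exact: th0.
- exact: smooth_circle.
- by rewrite /circle cos0 sin0 scale1r scale0r addr0.
- by rewrite /circle scalerDr !scalerA ![_ * r]mulrC.
- by rewrite mul0r subr0.
- move=> t _; have d := is_derive_circle (r *: v) (r *: w) t.
  rewrite /speed derive1E derive_val /circle -scalerN !scalerA ![_ * r]mulrC.
  rewrite enorm_rotation ?cos2Dsin2// scalerN -scaleNr -mulrN.
  rewrite [X in enorm X]addrC enorm_rotation ?sqrrN ?[_ + cos _ ^+ 2]addrC ?cos2Dsin2//.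
  by rewrite -phiE// mulrC.
- move=> t _.
  by apply: is_derive_eq; rewrite /GRing.scale/=; ring.
- by apply: continuous_subspaceT => t; exact: cvg_cst.
Qed.

Context (s0 : s 0 = 0).

Lemma gdist_through_origin (a b : R) v w : 0 <= a -> 0 <= b ->
  enorm v = 1 -> enorm w = 1 ->
  (gdist u (a *: v) (b *: w) <= (s a + s b)%:E)%E.
Proof.
move=> a0 b0 v1 w1.
have p1 := path_inwards 0 (lexx 0) a0 v1.
have p2 := path_outwards 0 (lexx 0) b0 w1.
rewrite scale0r s0 !subr0 in p1; rewrite scale0r s0 !subr0 in p2.
exact: gdist_le_path (path_of_length_cat p1 p2).
Qed.

Lemma gdist_around (a b r : R) v w : (2 <= n)%N -> 0 <= a -> 0 <= b -> a <= r -> b <= r ->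
  enorm v = 1 -> enorm w = 1 ->
  (gdist u (a *: v) (b *: w) <=
   ((s r - s a) + (s r - s b) + pi * (r * expR (phi r)))%:E)%E.
Proof.
move=> n2 a0 b0 ar br v1 w1.
have r0 := le_trans a0 ar.
have [theta [z [/andP[th0 thpi] z1 vz wE]]] := unit_rotation n2 v1 w1.
have p1 := path_outwards r a0 ar v1.
have p2 := path_arc r0 th0 v1 z1 vz.
have p3 := path_inwards (theta + r) b0 br w1.
rewrite subrr in p1; rewrite -wE in p2; rewrite addrK in p3.
apply: le_trans (gdist_le_path (path_of_length_cat (path_of_length_cat p1 p2) p3)) _.
rewrite lee_fin -addrA [_ * _ + _]addrC addrA lerD2l ler_wpM2r//.
by rewrite mulr_ge0// expR_ge0.
Qed.

End smooth_pieces.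

(** * The diameter bound *)

Theorem proposition6p1 (R : realType) (n : nat) (u : R -> R)
  (hn : (2 <= n)%N)
  (hu : smooth (fun x : 'rV[R]_n => u (enorm x)))
  (hK : forall r : R, 0 < r -> derive1n 2 u r + derive1 u r / r + expR (2 * u r) <= 0) :
  (gdiam n u <= (pi : R)%:E)%E.
Proof.
have [phi [dphi [ddphi [phiE d1 d2 dE]]]] := radial_profile (ltnW hn) hu.
have cphi : continuous phi.
  move=> r; apply/differentiable_continuous/derivable1_diffP.
  by have [] := d1 r.
have ce : continuous (fun r => expR (phi r)).
  by move=> r; apply: (@continuous_comp _ _ _ phi (@expR R)); [exact: cphi|exact: continuous_expR].
have [s s0 ds] := exists_primitive ce.
have spi : forall r : R, 0 <= r -> s r < pi.
  apply: (radius_lt_pi d1 d2 _ ds s0) => r r0.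
  by have [-> ->] := dE r r0; rewrite (phiE _ (ltW r0)); exact: hK.
apply: ge_ereal_sup => _ [x _ [y _ <-]].
pose e : 'rV[R]_n := delta_mx 0 (Ordinal (ltnW hn)).
have e1 : enorm e = 1 by exact: enorm_delta.
have [v v1 ->] := polar_decomposition x e1.
have [w w1 ->] := polar_decomposition y e1.
set a := enorm x; set b := enorm y.
have a0 : 0 <= a by exact: enorm_ge0.
have b0 : 0 <= b by exact: enorm_ge0.
apply/lee_addgt0Pr => eps eps0.
have epi : 0 < eps / pi by rewrite divr_gt0// pi_gt0.
have [r rM [r0 small]] := small_circle ds s0 spi (Num.max a b) epi.
have [ar br] : a <= r /\ b <= r by move: rM; rewrite ge_max => /andP.
have {}small : pi * (r * expR (phi r)) <= eps.
  by rewrite mulrC -ler_pdivlMr// pi_gt0.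
have := gdist_through_origin phiE cphi ds s0 a0 b0 v1 w1.
have := gdist_around phiE cphi ds hn a0 b0 ar br v1 w1.
have := spi r (ltW r0).
(* Go through the origin if that is short enough, else around a far circle. *)
case: (leP (s a + s b) pi) => [ab srpi _ h|ab srpi h _]; apply: le_trans h _.
  by rewrite -EFinD lee_fin; lra.
by rewrite -EFinD lee_fin; lra.
Qed.
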